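(* Let $(\mathcal{H}_1,\mathfrak{A}_0)$ and $(\mathcal{H}_2,\mathfrak{B}_0)$ be unital Hilbert quasi *-algebras. Then the tensor product Hilbert quasi *-algebra $(\mathcal{H}_1\widehat{\otimes}^h\mathcal{H}_2,\mathfrak{A}_0\otimes\mathfrak{B}_0)$ is *-semisimple and fully representable.
   Context: All vector spaces are complex, and inner products are linear in the first variable. Quasi *-algebra: a pair $(\mathfrak{A},\mathfrak{A}_0)$ consisting of a vector space $\mathfrak{A}$ and a *-algebra $\mathfrak{A}_0$ contained in $\mathfrak{A}$ as a subspace such that (i) $\mathfrak{A}$ carries an involution $a\mapsto a^*$ extending that of $\mathfrak{A}_0$; (ii) $\mathfrak{A}$ is a bimodule over $\mathfrak{A}_0$ and the module multiplications extend the multiplication of $\mathfrak{A}_0$, in particular $(xa)y=x(ay)$ and $a(xy)=(ax)y$ for all $a\in\mathfrak{A}$, $x,y\in\mathfrak{A}_0$; (iii) $(ax)^*=x^*a^*$ for all $a\in\mathfrak{A}$, $x\in\mathfrak{A}_0$. It is unital if there is $\mathbb{1}\in\mathfrak{A}_0$ with $a\mathbb{1}=a=\mathbb{1}a$ for all $a\in\mathfrak{A}$. It is a normed quasi *-algebra if $\mathfrak{A}$ has a norm $\|\cdot\|$ with $\|a^*\|=\|a\|$ for all $a$, $\mathfrak{A}_0$ dense in $\mathfrak{A}$, and $a\mapsto ax$ continuous on $\mathfrak{A}$ for every $x\in\mathfrak{A}_0$. Hilbert quasi *-algebra: let $\mathfrak{A}_0$ be a *-algebra which is also a pre-Hilbert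 space with inner product $\langle\cdot|\cdot\rangle$ such that (1) for each $x\in\mathfrak{A}_0$ the map $y\in\mathfrak{A}_0\mapsto xy\in\mathfrak{A}_0$ is continuous for the norm defined by the inner product; (2) $\langle xy|z\rangle=\langle y|x^*z\rangle$ for all $x,y,z\in\mathfrak{A}_0$; (3) $\langle x|y\rangle=\langle y^*|x^*\rangle$ for all $x,y\in\mathfrak{A}_0$; (4) $\mathfrak{A}_0^2=\{xy:x,y\in\mathfrak{A}_0\}$ is total in $\mathfrak{A}_0$. If $\mathcal{H}$ is the Hilbert space completion of $\mathfrak{A}_0$, then $(\mathcal{H},\mathfrak{A}_0)$ is called a Hilbert quasi *-algebra. The involution of $\mathfrak{A}_0$ and left and right multiplications by elements of $\mathfrak{A}_0$ are extended to $\mathcal{H}$ by continuity, making $(\mathcal{H},\mathfrak{A}_0)$ a normed quasi *-algebra with the Hilbert norm. Tensor product Hilbert quasi *-algebra: for unital Hilbert quasi *-algebras $(\mathcal{H}_1,\mathfrak{A}_0)$, $(\mathcal{H}_2,\mathfrak{B}_0)$ with inner products $\langle\cdot|\cdot\rangle_1,\langle\cdot|\cdot\rangle_2$, the algebraic tensor product $\mathfrak{A}_0\otimes\mathfrak{B}_0$ is a *-algebra with $(x\otimes y)(x'\otimes y')=xx'\otimes yy'$ and $(x\otimes y)^*=x^*\otimes y^*$ (extended linearly, resp. conjugate-linearly). $\mathcal{H}_1\widehat{\otimes}^h\mathcal{H}_2$ is the completion of the algebraic tensor product $\mathcal{H}_1\otimes\mathcal{H}_2$ (equivalently, of its dense subspace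 $\mathfrak{A}_0\otimes\mathfrak{B}_0$) with respect to the inner product $\langle\sum_i\xi_i\otimes\eta_i|\sum_j\xi'_j\otimes\eta'_j\rangle=\sum_{i,j}\langle\xi_i|\xi'_j\rangle_1\langle\eta_i|\eta'_j\rangle_2$. The pair $(\mathcal{H}_1\widehat{\otimes}^h\mathcal{H}_2,\mathfrak{A}_0\otimes\mathfrak{B}_0)$ is a unital Hilbert quasi *-algebra, called the tensor product Hilbert quasi *-algebra. Representable functionals: a linear functional $\omega:\mathfrak{A}\to\mathbb{C}$ on a quasi *-algebra $(\mathfrak{A},\mathfrak{A}_0)$ is representable if (L.1) $\omega(x^*x)\ge 0$ for all $x\in\mathfrak{A}_0$; (L.2) $\omega(y^*a^*x)=\overline{\omega(x^*ay)}$ for all $x,y\in\mathfrak{A}_0$, $a\in\mathfrak{A}$; (L.3) for every $a\in\mathfrak{A}$ there is $\gamma_a>0$ with $|\omega(a^*x)|\le\gamma_a\,\omega(x^*x)^{1/2}$ for all $x\in\mathfrak{A}_0$. For a normed quasi *-algebra, $\mathcal{R}_c(\mathfrak{A},\mathfrak{A}_0)$ denotes the set of continuous representable functionals. For $\omega\in\mathcal{R}_c(\mathfrak{A},\mathfrak{A}_0)$ let $\varphi_\omega(x,y)=\omega(y^*x)$, $x,y\in\mathfrak{A}_0$. This form is closable, i.e. $\varphi_\omega(x_n,x_n)\to0$ for every sequence $\{x_n\}\subset\mathfrak{A}_0$ with $\|x_n\|\to0$ and $\varphi_\omega(x_n-x_m,x_n-x_m)\to0$. Let $\overline{\varphi}_\omega$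 be its closure, whose domain $\mathcal{D}(\overline{\varphi}_\omega)$ consists of those $a\in\mathfrak{A}$ for which there is a sequence $\{x_n\}\subset\mathfrak{A}_0$ with $\|x_n-a\|\to0$ and $\varphi_\omega(x_n-x_m,x_n-x_m)\to0$. Put $\mathfrak{A}_{\mathcal{R}}=\bigcap_{\omega\in\mathcal{R}_c(\mathfrak{A},\mathfrak{A}_0)}\mathcal{D}(\overline{\varphi}_\omega)$ (and $\mathfrak{A}_{\mathcal{R}}=\mathfrak{A}$ if $\mathcal{R}_c(\mathfrak{A},\mathfrak{A}_0)=\{0\}$). Let $\mathfrak{A}_0^+=\{\sum_{k=1}^n x_k^*x_k: x_k\in\mathfrak{A}_0,\ n\in\mathbb{N}\}$ and let $\mathfrak{A}^+$ be the norm closure of $\mathfrak{A}_0^+$ in $\mathfrak{A}$. A linear functional $\omega$ on $\mathfrak{A}$ is positive if $\omega(a)\ge0$ for every $a\in\mathfrak{A}^+$. A family $\mathcal{F}$ of positive linear functionals on $\mathfrak{A}$ is sufficient if for every $a\in\mathfrak{A}^+$, $a\ne0$, there is $\omega\in\mathcal{F}$ with $\omega(a)>0$. Fully representable: a normed quasi *-algebra $(\mathfrak{A},\mathfrak{A}_0)$ is fully representable if $\mathcal{R}_c(\mathfrak{A},\mathfrak{A}_0)$ is sufficient and $\mathfrak{A}_{\mathcal{R}}=\mathfrak{A}$. *-Semisimple: let $\mathcal{S}_{\mathfrak{A}_0}(\mathfrak{A})$ be the family of all continuous sesquilinear forms $\Omega:\mathfrak{A}\times\mathfrak{A}\to\mathbb{C}$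 such that (i) $\Omega(a,a)\ge0$ for all $a\in\mathfrak{A}$; (ii) $\Omega(ax,y)=\Omega(x,a^*y)$ for all $a\in\mathfrak{A}$, $x,y\in\mathfrak{A}_0$; (iii) $|\Omega(a,b)|\le\|a\|\,\|b\|$ for all $a,b\in\mathfrak{A}$. A normed quasi *-algebra $(\mathfrak{A},\mathfrak{A}_0)$ is *-semisimple if for every $0\ne a\in\mathfrak{A}$ there is $\Omega\in\mathcal{S}_{\mathfrak{A}_0}(\mathfrak{A})$ with $\Omega(a,a)>0$. *)

(* Defs.v *)
(* MathComp-Analysis; the complex numbers are R[i] for R : realType. *)
From HB Require Import structures.
From mathcomp Require Import all_boot all_order all_algebra.
From mathcomp Require Import complex sesquilinear.
From mathcomp Require Import all_classical all_reals all_analysis.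

Set Implicit Arguments.
Unset Strict Implicit.
Unset Printing Implicit Defensive.

Import Order.TTheory GRing.Theory Num.Theory numFieldNormedType.Exports.

Local Open Scope classical_set_scope.
Local Open Scope ring_scope.
Local Open Scope complex_scope.

(* The library's ring structures are unital; a *-algebra need not be, and the
   zero algebra is allowed, so the product is an operation on a C-module. *)
HB.mixin Record Lmodule_isStarAlgebra (R : realType) A
    of GRing.Lmodule R[i] A := {
  smul : A -> A -> A;
  star : A -> A;
  smulA : associative smul;
  smul_linearl : forall y, linear (smul ^~ y);
  smul_linearr : forall x, linear (smul x);
  star_antilinear : linear_for (@Num.conj R[i] \; *:%R) star;
  starK : involutive star;
  starM : forall x y, star (smul x y) = smul (star y) (star x)
}.

#[short(type="starAlgType")]
HB.structure Definition StarAlgebra (R : realType) :=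
  {A of GRing.Lmodule R[i] A & Lmodule_isStarAlgebra R A}.

(* [{dot V for Num.conj}]: positive definite hermitian forms, linear in the
   first variable and conjugate-linear in the second one. *)
HB.mixin Record NormedModule_isPreHilbert (R : realType) V
    of NormedModule R[i] V := {
  dotp : {dot V for (@Num.conj R[i])};
  normr_dotp : forall x : V, `|x| ^+ 2 = dotp x x
}.

#[short(type="preHilbertType")]
HB.structure Definition PreHilbert (R : realType) :=
  {V of NormedModule R[i] V & NormedModule_isPreHilbert R V}.

#[short(type="hilbertType")]
HB.structure Definition Hilbert (R : realType) :=
  {V of CompleteNormedModule R[i] V & NormedModule_isPreHilbert R V}.

#[short(type="preHilbertStarAlgType")]
HB.structure Definition PreHilbertStarAlgebra (R : realType) :=
  {A of PreHilbert R A & StarAlgebra R A}.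

Definition lin_span (R : realType) (V : lmodType R[i]) (S : set V) : set V :=
  [set v | exists (n : nat) (c : 'I_n -> R[i]) (s : 'I_n -> V),
     (forall i, S (s i)) /\ v = \sum_i c i *: s i].

HB.mixin Record PreHilbertStarAlgebra_isHilbertAlgebra (R : realType) A
    of PreHilbertStarAlgebra R A := {
  smul_continuous : forall x : A, continuous (smul x);
  dotp_smul : forall x y z : A, dotp (smul x y) z = dotp y (smul (star x) z);
  dotp_star : forall x y : A, dotp x y = dotp (star y) (star x);
  smul_total : dense (lin_span [set z : A | exists x y, z = smul x y])
}.

#[short(type="hilbertAlgType")]
HB.structure Definition HilbertAlgebra (R : realType) :=
  {A of PreHilbertStarAlgebra R A & PreHilbertStarAlgebra_isHilbertAlgebra R A}.

Section QuasiStarAlgebra.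
Context {R : realType}.

(* A0 is regarded as a subspace of A through the injection [qinj];
   [lmul x a] is x a and [rmul a x] is a x. *)
Record quasiStarAlg (A0 : starAlgType R) (A : lmodType R[i]) :=
    QuasiStarAlg {
  qinj : {linear A0 -> A};
  qstar : A -> A;
  lmul : A0 -> A -> A;
  rmul : A -> A0 -> A;
  qinj_inj : injective qinj;
  qstar_antilinear : linear_for (@Num.conj R[i] \; *:%R) qstar;
  qstarK : involutive qstar;
  qstar_qinj : forall x, qstar (qinj x) = qinj (star x);
  lmul_linearl : forall a, linear (lmul ^~ a);
  lmul_linearr : forall x, linear (lmul x);
  rmul_linearl : forall x, linear (rmul ^~ x);
  rmul_linearr : forall a, linear (rmul a);
  lmul_qinj : forall x y, lmul x (qinj y) = qinj (smul x y);
  rmul_qinj : forall x y, rmul (qinj x) y = qinj (smul x y);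
  lmulA : forall x y a, lmul (smul x y) a = lmul x (lmul y a);
  rmulA : forall a x y, rmul a (smul x y) = rmul (rmul a x) y;
  lrmulA : forall x a y, rmul (lmul x a) y = lmul x (rmul a y);
  qstar_rmul : forall a x, qstar (rmul a x) = lmul (star x) (qstar a)
}.

Record normedQuasiStarAlg (A0 : starAlgType R) (A : normedModType R[i]) :=
    NormedQuasiStarAlg {
  nq_quasi :> quasiStarAlg A0 A;
  nq_norm_star : forall a, `|qstar nq_quasi a| = `|a|;
  nq_dense : dense (range (qinj nq_quasi));
  nq_rmul_continuous : forall x, continuous ((rmul nq_quasi)^~ x)
}.

(* H is the Hilbert space completion of A0, through the isometry [hq_inj]; the
   operations on H are the (unique) continuous extensions of those of A0. *)
Record hilbertQuasiStarAlg (A0 : hilbertAlgType R) (H : hilbertType R) :=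
    HilbertQuasiStarAlg {
  hq_inj : {linear A0 -> H};
  hq_dotp : forall x y, dotp (hq_inj x) (hq_inj y) = dotp x y;
  hq_dense : dense (range hq_inj);
  hq_star : H -> H;
  hq_star_continuous : continuous hq_star;
  hq_star_inj : forall x, hq_star (hq_inj x) = hq_inj (star x);
  hq_lmul : A0 -> H -> H;
  hq_lmul_continuous : forall x, continuous (hq_lmul x);
  hq_lmul_inj : forall x y, hq_lmul x (hq_inj y) = hq_inj (smul x y);
  hq_rmul : H -> A0 -> H;
  hq_rmul_continuous : forall x, continuous (hq_rmul ^~ x);
  hq_rmul_inj : forall x y, hq_rmul (hq_inj x) y = hq_inj (smul x y)
}.

End QuasiStarAlgebra.

Section Notions.
Context {R : realType}.

Section Quasi.
Context {A0 : starAlgType R} {A : lmodType R[i]} (X : quasiStarAlg A0 A).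

Definition unital : Prop :=
  exists e : A0, forall a : A, rmul X a e = a /\ lmul X e a = a.

Definition representable (w : {scalar A}) : Prop :=
  [/\ forall x : A0, 0 <= w (qinj X (smul (star x) x)),
      forall (x y : A0) (a : A),
        w (rmul X (lmul X (star y) (qstar X a)) x) =
        Num.conj (w (rmul X (lmul X (star x) a) y)) &
      forall a : A, exists2 g : R[i], 0 < g & forall x : A0,
        `|w (rmul X (qstar X a) x)| <=
          g * sqrtC (w (qinj X (smul (star x) x)))].

Definition assoc_form (w : {scalar A}) (x y : A0) : R[i] :=
  w (qinj X (smul (star y) x)).

Definition pos_cone0 : set A0 :=
  [set z | exists (n : nat) (s : 'I_n -> A0),
     z = \sum_i smul (star (s i)) (s i)].

End Quasi.

Section Normed.
Context {A0 : starAlgType R} {A : normedModType R[i]}.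
Variable X : normedQuasiStarAlg A0 A.

Definition cont_representable : set {scalar A} :=
  [set w | representable X w /\ continuous (w : A -> R[i]^o)].

Definition closure_domain (w : {scalar A}) : set A :=
  [set a | exists x : nat -> A0,
     qinj X (x n) @[n --> \oo] --> a /\
     assoc_form X w (x nm.1 - x nm.2) (x nm.1 - x nm.2) @[nm --> (\oo, \oo)]
       --> (0 : R[i]^o)].

(* The first disjunct is the convention for the case where the only continuous
   representable functional is 0. *)
Definition repr_domain : set A :=
  [set a | (forall w, cont_representable w -> forall b, w b = 0) \/
           (forall w, cont_representable w -> closure_domain w a)].

Definition pos_cone : set A := closure (qinj X @` pos_cone0).

Definition positive_functional (w : {scalar A}) : Prop :=
  forall a, pos_cone a -> 0 <= w a.

Definition sufficient (F : set {scalar A}) : Prop :=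
  F `<=` positive_functional /\
  forall a, pos_cone a -> a != 0 -> exists2 w, F w & 0 < w a.

Definition fully_representable : Prop :=
  sufficient cont_representable /\ repr_domain = setT.

Definition invariant_form :
    set {bilinear A -> A -> R[i] | *%R & @Num.conj R[i] \; *%R} :=
  [set W | [/\ continuous (fun p : A * A => W p.1 p.2 : R[i]^o),
     forall a, 0 <= W a a,
     forall (a : A) (x y : A0),
       W (rmul X a x) (qinj X y) = W (qinj X x) (rmul X (qstar X a) y) &
     forall a b, `|W a b| <= `|a| * `|b|]].

Definition star_semisimple : Prop :=
  forall a : A, a != 0 -> exists2 W, invariant_form W & 0 < W a a.

End Normed.

(* W, with the bilinear map t, is the algebraic tensor product of U and V. *)
Definition is_alg_tensor (U V W : lmodType R[i])
    (t : {bilinear U -> V -> W}) : Prop :=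
  forall (E : lmodType R[i]) (f : {bilinear U -> V -> E}),
    exists g : {linear W -> E}, (forall u v, g (t u v) = f u v) /\
      forall h : {linear W -> E}, (forall u v, h (t u v) = f u v) -> h =1 g.

End Notions.

(* The pair (H, A0) of a Hilbert quasi *-algebra is a normed quasi *-algebra for
   the Hilbert norm: all identities extend from A0 to H by density. *)
Section HilbertNormed.
Context {R : realType}.

Lemma eq_on_dense (H K : normedModType R[i]) (S : set H) (f g : H -> K) :
  dense S -> continuous f -> continuous g -> (forall x, S x -> f x = g x) ->
  f =1 g.
Proof.
move=> dS cf cg fg x; apply/eqP; apply: contrapT => /negP fgx.
have := @dS [set y | f y - g y != 0].
case.
- by exists x; rewrite /= subr_eq0.
- have -> : [set y | f y - g y != 0] = (fun y => f y - g y) @^-1` (~` [set 0]).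
    by apply/seteqP; split=> y /= /eqP.
  apply: open_comp; first by move=> y _; apply: cvgB; [apply: cf|apply: cg].
  by apply: closed_openC; apply: accessible_closed_set1; apply: hausdorff_accessible; exact: norm_hausdorff.
- by move=> y [/= /negP + Sy]; apply; rewrite (fg _ Sy) subrr.
Qed.

Context {A0 : hilbertAlgType R} {H : hilbertType R}.
Variable X : hilbertQuasiStarAlg A0 H.

Lemma hq_ext (K : normedModType R[i]) (f g : H -> K) :
  continuous f -> continuous g ->
  (forall x, f (hq_inj X x) = g (hq_inj X x)) -> f =1 g.
Proof.
move=> cf cg fg; apply: (eq_on_dense (@hq_dense _ _ _ X)) => //.
by move=> _ [x _ <-].
Qed.

Lemma continuous_lin (K : normedModType R[i]) (c : R[i]) (f g : H -> K) :
  continuous f -> continuous g -> continuous (fun x => c *: f x + g x).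
Proof.
by move=> cf cg x; apply: cvgD; [apply: cvgZr; exact: cf|exact: cg].
Qed.

Lemma hq_linear (s : R[i] -> R[i]) (f : H -> H) : continuous f ->
  (forall c x y, f (hq_inj X (c *: x + y)) =
     s c *: f (hq_inj X x) + f (hq_inj X y)) ->
  forall c a b, f (c *: a + b) = s c *: f a + f b.
Proof.
move=> cf fl c a b; move: a.
have cid' : continuous (@idfun H) by move=> ?; exact: cvg_id.
have cst_c (k : H) : continuous (fun _ : H => k) by move=> ?; exact: cvg_cst.
apply: hq_ext.
- by move=> a; apply: continuous_comp; [exact: continuous_lin|exact: cf].
- exact: continuous_lin.
move=> x; move: b; apply: hq_ext.
- move=> b; apply: continuous_comp; last exact: cf.
  exact: (@continuous_lin H c (fun=> hq_inj X x) idfun).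
- exact: (@continuous_lin H (s c) (fun=> f (hq_inj X x)) f).
- by move=> y; rewrite -fl linearP.
Qed.

Lemma hq_inj_inj : injective (hq_inj X).
Proof.
move=> x y /eqP; rewrite -subr_eq0 -linearB => /eqP h.
apply/eqP; rewrite -subr_eq0 -normr_eq0 -sqrf_eq0 normr_dotp -(hq_dotp X) h.
by rewrite -normr_dotp normr0 expr0n.
Qed.

Let cL := @hq_lmul_continuous _ _ _ X.
Let cR := @hq_rmul_continuous _ _ _ X.
Let cS := @hq_star_continuous _ _ _ X.
Let cc (f g : H -> H) : continuous f -> continuous g -> continuous (f \o g).
Proof. by move=> cf cg a; apply: continuous_comp; [exact: cg|exact: cf]. Qed.
Let cI : continuous (@idfun H). Proof. by move=> ?; exact: cvg_id. Qed.

Lemma hq_star_antilinear : linear_for (@Num.conj R[i] \; *:%R) (hq_star X).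
Proof.
apply: (@hq_linear Num.conj _ cS) => c x y.
by rewrite !hq_star_inj star_antilinear linearP.
Qed.

Lemma hq_starK : involutive (hq_star X).
Proof. by apply: hq_ext (cc cS cS) cI _ => x; rewrite /= !hq_star_inj starK. Qed.

Lemma hq_lmul_linearl a : linear ((hq_lmul X)^~ a).
Proof.
move=> c x y; move: a; apply: hq_ext; [exact: cL|exact: continuous_lin|].
by move=> z; rewrite !hq_lmul_inj smul_linearl linearP.
Qed.

Lemma hq_lmul_linearr x : linear (hq_lmul X x).
Proof.
move=> c y z; apply: (@hq_linear id _ (@cL x)) => {}c {}y {}z.
by rewrite !hq_lmul_inj smul_linearr linearP.
Qed.

Lemma hq_rmul_linearl x : linear ((hq_rmul X)^~ x).
Proof.
move=> c y z; apply: (@hq_linear id _ (@cR x)) => {}c {}y {}z.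
by rewrite !hq_rmul_inj smul_linearl linearP.
Qed.

Lemma hq_rmul_linearr a : linear (hq_rmul X a).
Proof.
move=> c x y; move: a; apply: hq_ext; [exact: cR|exact: continuous_lin|].
by move=> z; rewrite !hq_rmul_inj smul_linearr linearP.
Qed.

Lemma hq_lmulA x y a :
  hq_lmul X (smul x y) a = hq_lmul X x (hq_lmul X y a).
Proof.
move: a; apply: hq_ext; [exact: cL|exact: (cc (@cL x) (@cL y))|].
by move=> z; rewrite !hq_lmul_inj smulA.
Qed.

Lemma hq_rmulA a x y :
  hq_rmul X a (smul x y) = hq_rmul X (hq_rmul X a x) y.
Proof.
move: a; apply: hq_ext; [exact: cR|exact: (cc (@cR y) (@cR x))|].
by move=> z; rewrite !hq_rmul_inj smulA.
Qed.

Lemma hq_lrmulA x a y :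
  hq_rmul X (hq_lmul X x a) y = hq_lmul X x (hq_rmul X a y).
Proof.
move: a; apply: hq_ext;
  [exact: (cc (@cR y) (@cL x))|exact: (cc (@cL x) (@cR y))|].
by move=> z; rewrite !(hq_rmul_inj, hq_lmul_inj) smulA.
Qed.

Lemma hq_star_rmul a x :
  hq_star X (hq_rmul X a x) = hq_lmul X (star x) (hq_star X a).
Proof.
move: a; apply: hq_ext;
  [exact: (cc cS (@cR x))|exact: (cc (@cL (star x)) cS)|].
by move=> z; rewrite !(hq_rmul_inj, hq_star_inj, hq_lmul_inj) starM.
Qed.

Lemma hq_norm_inj x : `|hq_inj X x| = `|x|.
Proof.
by apply/eqP; rewrite -(@eqrXn2 _ 2)// !normr_dotp hq_dotp.
Qed.

Lemma hq_norm_star a : `|hq_star X a| = `|a|.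
Proof.
move: a; apply: (@hq_ext R[i]^o (fun a => `|hq_star X a|) (fun a => `|a|)).
- by move=> a; apply: cvg_norm; exact: cS.
- by move=> a; apply: cvg_norm; exact: cvg_id.
move=> x /=; rewrite hq_star_inj !hq_norm_inj.
by apply/eqP; rewrite -(@eqrXn2 _ 2)// !normr_dotp -dotp_star.
Qed.

Definition hilbert_quasi : quasiStarAlg A0 H :=
  QuasiStarAlg hq_inj_inj hq_star_antilinear hq_starK (hq_star_inj X)
    hq_lmul_linearl hq_lmul_linearr hq_rmul_linearl hq_rmul_linearr
    (hq_lmul_inj X) (hq_rmul_inj X) hq_lmulA hq_rmulA hq_lrmulA hq_star_rmul.

Definition hilbert_normed_quasi : normedQuasiStarAlg A0 H :=
  @NormedQuasiStarAlg _ _ _ hilbert_quasi hq_norm_star (@hq_dense _ _ _ X)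
    (@hq_rmul_continuous _ _ _ X).

End HilbertNormed.

Coercion hilbert_normed_quasi :
  hilbertQuasiStarAlg >-> normedQuasiStarAlg.

(* [t x y] and [th a b] stand for the elementary tensors of A0 (x) B0 and of
   H1 (x) H2.  A0 (x) B0 is T0, with its *-algebra structure determined by the
   elementary tensors.  By [tp_dotp] the linear map from the algebraic tensor
   product of H1 and H2 to H induced by th is isometric, hence injective, and by
   [tp_dense] H is the completion; [tp_compat] identifies A0 (x) B0 with a
   subspace of H1 (x) H2, so that the inner product of T0 is also given by the
   product formula. *)
Record is_tensor_hilbert_quasi (R : realType) (A0 B0 T0 : hilbertAlgType R)
    (H1 H2 H : hilbertType R) (X : hilbertQuasiStarAlg A0 H1)
    (Y : hilbertQuasiStarAlg B0 H2) (Z : hilbertQuasiStarAlg T0 H)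
    (t : {bilinear A0 -> B0 -> T0}) (th : {bilinear H1 -> H2 -> H}) : Prop :=
    IsTensorHilbertQuasi {
  tp_alg : is_alg_tensor t;
  tp_mul : forall x y x' y',
    smul (t x y) (t x' y') = t (smul x x') (smul y y');
  tp_star : forall x y, star (t x y) = t (star x) (star y);
  tp_dotp : forall a b a' b',
    dotp (th a b) (th a' b') = dotp a a' * dotp b b';
  tp_dense : dense (lin_span [set c | exists a b, c = th a b]);
  tp_compat : forall x y, th (hq_inj X x) (hq_inj Y y) = hq_inj Z (t x y)
}.

(* Main.v *)
Require Import Defs.
From HB Require Import structures.
From mathcomp Require Import all_boot all_order all_algebra.
From mathcomp Require Import complex sesquilinear.
From mathcomp Require Import all_classical all_reals all_analysis.
From mathcomp Require Import ring.

Import Order.TTheory GRing.Theory Num.Theory numFieldNormedType.Exports.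

Local Open Scope classical_set_scope.
Local Open Scope ring_scope.

(** The tensor product enters only through its unit: the elementary tensor of the
    two units acts as the identity on elementary tensors, hence on all of T0 by
    the universal property, hence on H by density.  What remains is a statement
    about a single unital Hilbert quasi *-algebra (H, A0).

    *-Semisimplicity: the inner product itself is an invariant form.  It is
    positive definite and bounded by the Cauchy-Schwarz inequality, and its
    invariance extends from A0 to H by density.

    Sufficiency: each x in A0 gives the continuous representable functional
    a |-> <a x | x>, which is nonnegative on the positive cone.  If all of these
    vanish at a, the sesquilinear form <a x | y> vanishes by polarization, so
    that a x = 0 for every x, and the choice of x as the unit gives a = 0.

    Every a in H lies in the domain of the closure of the form of each continuous
    representable w: the form is in fact bounded.  The functionals
    a |-> w(x^* a) with w(x^* x) <= 1 are continuous, and they are pointwise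
    bounded because w(x^* a) is the conjugate of w(a^* x), which representability
    bounds by a multiple of w(x^* x)^(1/2) depending on a only.  The uniform
    boundedness principle on the complete space H yields M with
    |w(x^* a)| <= M |a|.  For a := x, homogeneity turns this into
    w(x^* x) <= M^2 |x|^2 for every x in A0, so every sequence of A0 that
    converges to a in norm is Cauchy for the form. *)

Set Implicit Arguments.
Unset Strict Implicit.
Unset Printing Implicit Defensive.

(** * Uniform boundedness over the complex numbers *)

Section UniformBoundedness.
Context {R : realType}.
Local Notation C := R[i].

(** A nonnegative complex number is real, so the archimedean property of R
    applies to it. *)
Lemma natr_gt_complex (M : C) : 0 <= M -> exists n, M < n%:R.
Proof.
move=> M0; have/RRe_real <- := ger0_real M0.
exists (Num.truncn (complex.Re M)).+1.
by rewrite -(rmorph_nat (real_complex R)) ltcR truncnS_gt.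
Qed.

Lemma invSn_lt_complex (e : C) : 0 < e -> exists n, n.+1%:R^-1 < e.
Proof.
move=> e0; have [n en] := natr_gt_complex (ltW (etrans (invr_gt0 e) e0)).
exists n; rewrite -(invrK e) ltf_pV2 ?posrE ?invr_gt0 ?ltr0n//.
by rewrite (lt_trans en)// ltr_nat.
Qed.

Lemma closed_coincidence (K : numFieldType) (T : topologicalType)
    (V : normedModType K) (f g : T -> V) :
  continuous f -> continuous g -> closed [set x | f x = g x].
Proof.
move=> cf cg.
have -> : [set x | f x = g x] = (fun x => f x - g x) @^-1` [set 0].
  by apply/seteqP; split=> x /= /eqP; [rewrite -subr_eq0|rewrite subr_eq0] => /eqP.
apply: preimage_closed; first by move=> x _; apply: cvgB; [exact: cf|exact: cg].
by apply: accessible_closed_set1; apply: hausdorff_accessible; exact: norm_hausdorff.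
Qed.

(** The order of R[i] is partial, so this is not a statement about half-lines; but
    0 <= z is the closed condition `|z| = z. *)
Lemma closed_ge0_complex : closed [set z : C^o | 0 <= z].
Proof.
have -> : [set z : C^o | 0 <= z] = [set z : C^o | (`|z| : C^o) = z].
  by apply/seteqP; split=> z /=; rewrite ger0_def => /eqP.
apply: (@closed_coincidence C C^o C^o (fun z => `|z|) id).
  exact: (@norm_continuous C C^o).
by move=> z; exact: cvg_id.
Qed.

Lemma closed_norm_le (V : normedModType C) (x : V) (r : C) :
  closed [set z | `|z - x| <= r].
Proof.
pose f (z : V) : C^o := r - `|z - x|.
have -> : [set z | `|z - x| <= r] = f @^-1` [set z : C^o | 0 <= z].
  by apply/seteqP; split=> z /=; rewrite subr_ge0.
apply: preimage_closed; last exact: closed_ge0_complex.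
move=> z _; apply: (@cvgB C C^o); first exact: cvg_cst.
by apply: cvg_norm; apply: cvgB; [exact: cvg_id|exact: cvg_cst].
Qed.

(** One step of the nested-ball argument.  A functional f that is large on some
    vector v of norm r / 2 is large at x + v or at x - v, because 2 f(v) is
    f(x + v) - f(x - v); by continuity it stays large on a small ball around
    that point. *)
Lemma unbounded_step (V : normedModType C) (F : set {scalar V}) :
  (forall f, F f -> continuous (f : V -> C^o)) ->
  (forall M : C, 0 < M -> exists f, F f /\ exists x, M * `|x| < `|f x|) ->
  forall (n : nat) (x : V) (r : C), 0 < r ->
  exists y, exists2 s : C, 0 < s &
    [/\ s <= n.+1%:R^-1, forall z, `|z - y| <= s -> `|z - x| <= r &
      exists2 f, F f & forall z, `|z - y| <= s -> n%:R <= `|f z|].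
Proof.
move=> Fc Fub n x r r0.
have r20 : 0 < r / 2 by rewrite divr_gt0.
(* The constant makes `|f v| exceed n + 1 once u is rescaled to norm r / 2; the
   spare 1 is what continuity is allowed to lose. *)
have [|f [Ff [u fu]]] := Fub (n.+1%:R / (r / 2)).
  by rewrite divr_gt0// ltr0n.
have u0 : 0 < `|u|.
  rewrite normr_gt0; apply: contraTneq fu => ->.
  by rewrite linear0 !normr0 mulr0 ltxx.
pose v := (r / 2 / `|u|) *: u.
have vr : `|v| = r / 2.
  by rewrite normrZ gtr0_norm ?divr_gt0// divfK// gt_eqF.
have fv : n.+1%:R < `|f v|.
  rewrite linearZ normrM gtr0_norm; last by rewrite divr_gt0.
  rewrite mulrAC ltr_pdivlMr// -ltr_pdivrMl//.
  by rewrite mulrA (mulrC (r / 2)^-1).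
have [y xy fy] : exists2 y, `|y - x| <= r / 2 & n.+1%:R <= `|f y|.
  have [le1|lt1] := boolP (n.+1%:R <= `|f (x + v)|).
    by exists (x + v) => //; rewrite addrC addKr vr.
  have [le2|lt2] := boolP (n.+1%:R <= `|f (x - v)|).
    by exists (x - v) => //; rewrite addrC addKr normrN vr.
  rewrite -!real_ltNge ?realn// in lt1 lt2.
  have fv2 : f (x + v) - f (x - v) = f v *+ 2.
    by rewrite linearD linearB opprB addrC addrA subrK mulr2n.
  have := ltr_leD fv (ltW fv).
  rewrite -[X in _ < X]mulr2n -normrMn -fv2.
  move=> /lt_le_trans/(_ (ler_normB _ _))/lt_trans.
  by move=> /(_ _ (ltrD lt1 lt2)); rewrite ltxx.
have /cvgrPdist_lt/(_ 1 ltr01)/nbhs_ballP[d d0 dP] := Fc f Ff y.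
rewrite /= in d0.
(* A radius below n.+1^-1, r / 2 and d / 2 at once: the inverse of a sum,
   since the order of R[i] is partial. *)
pose q : C := n.+1%:R + 2 / r + 2 / d.
have [q1 q2 q3] : [/\ n.+1%:R <= q, 2 / r <= q & 2 / d <= q].
  have a1 : 0 <= (n.+1%:R : C) by rewrite ler0n.
  have a2 : 0 <= 2 / r by rewrite divr_ge0// ltW.
  have a3 : 0 <= 2 / d by rewrite divr_ge0// ltW.
  by split; rewrite /q; [rewrite -addrA lerDl addr_ge0|
    rewrite addrAC lerDr addr_ge0|rewrite lerDr addr_ge0].
have q0 : 0 < q by rewrite (lt_le_trans _ q1)// ltr0n.
have qle (c : C) : 0 < c -> 2 / c <= q -> q^-1 <= c / 2.
  move=> c0 cq; rewrite -[c / 2]invrK lef_pV2 ?posrE ?invr_gt0//.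
    by rewrite invf_div.
  by rewrite divr_gt0.
exists y, q^-1; first by rewrite invr_gt0.
split.
- by rewrite lef_pV2// posrE ltr0n.
- move=> z zy; rewrite -(subrK y z) -addrA (le_trans (ler_normD _ _))//.
  by rewrite [r]splitr lerD// (le_trans zy)// qle.
- exists f => // z zy.
  have : `|f y - f z| < 1.
    apply: dP; rewrite -ball_normE /ball_ /= distrC (le_lt_trans zy)//.
    by rewrite (le_lt_trans (qle _ d0 q3))// ltr_pdivrMr// ltr_pMr// ltr1n.
  move=> fyz; rewrite -(lerD2r 1) natr1 (le_trans fy)// -[f y](subrK (f z)) addrC.
  by rewrite (le_trans (ler_normD _ _))// lerD2l ltW.
Qed.

(** If no uniform bound exists, the steps above produce nested balls on the n-th
    of which some member of F is at least n in modulus; their radii tend to 0, so by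
    completeness they have a common point, at which F is not bounded. *)
Theorem uniform_boundedness (V : completeNormedModType C)
    (F : set {scalar V}) :
  (forall f, F f -> continuous (f : V -> C^o)) ->
  (forall x, exists M : C, forall f, F f -> `|f x| <= M) ->
  exists2 M : C, 0 < M & forall f, F f -> forall x, `|f x| <= M * `|x|.
Proof.
move=> Fc Fb; apply: contrapT => nM.
have Fub (M : C) : 0 < M -> exists f, F f /\ exists x, M * `|x| < `|f x|.
  move=> M0; apply: contrapT => nf; apply: nM; exists M => // f Ff x.
  have Mx : M * `|x| \is Num.real by rewrite ger0_real// mulr_ge0// ltW.
  apply: contrapT => /negP; rewrite -real_ltNge// => fx.
  by apply: nf; exists f; split=> //; exists x.
pose P (b : V * {posnum C}) : set V := [set z | `|z - b.1| <= b.2%:num].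
have step (nb : nat * (V * {posnum C})) : exists b : V * {posnum C},
    [/\ b.2%:num <= nb.1.+1%:R^-1, P b `<=` P nb.2 &
      exists2 f, F f & forall z, P b z -> nb.1%:R <= `|f z|].
  case: nb => [n [x r]].
  have [y [s s0 sP]] := unbounded_step Fc Fub n x [gt0 of r%:num].
  by exists (y, PosNum s0).
have [G GP] := choice step.
pose fix b n := if n is m.+1 then G (m, b m) else (0 : V, PosNum (@ltr01 C)).
have bS n m : (n <= m)%N -> P (b m) `<=` P (b n).
  elim: m => [|m IH]; first by rewrite leqn0 => /eqP ->.
  rewrite leq_eqVlt => /orP[/eqP -> //|/IH]; apply: subset_trans.
  by have [] := GP (m, b m).
have bb m : P (b m) (b m).1 by rewrite /P /= subrr normr0.
have /cvg_ex[l xl] : cvg ((b n).1 @[n --> \oo]).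
  apply: cauchy_cvg; apply: cauchy_exP => e /invSn_lt_complex[n ne].
  exists (b n.+1).1; exists n.+1 => // m /= nm.
  rewrite -ball_normE /ball_ /= distrC (le_lt_trans (bS _ _ nm _ (bb m)))//.
  by apply: le_lt_trans ne; have [] := GP (n, b n).
have lP n : P (b n) l.
  apply: (closed_cvg _ (@closed_norm_le V (b n).1 (b n).2%:num) _ _ xl).
  by exists n => // m /= nm; apply: bS nm _ (bb m).
have [M MP] := Fb l.
have M0 : 0 <= M by have [_ _ [f /MP + _]] := GP (0%N, b 0%N); apply: le_trans.
have [n Mn] := natr_gt_complex M0.
have [_ _ [f Ff fP]] := GP (n, b n).
have := le_trans (fP _ (lP n.+1)) (MP f Ff).
by move=> /(lt_le_trans Mn); rewrite ltxx.
Qed.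

End UniformBoundedness.

(** * Inner products *)

Section InnerProduct.
Context {R : realType}.
Local Notation C := R[i].

Section Form.
Context {V : preHilbertType R}.
Implicit Types a b : V.

Lemma dotpC a b : dotp b a = Num.conj (dotp a b).
Proof. by rewrite (hermC dotp) expr0 mul1r. Qed.

(** Expand the squared norm of `|b|^2 a - <a|b> b. *)
Lemma dotp_cauchy_schwarz a b : `|dotp a b| <= `|a| * `|b|.
Proof.
have [->|b0] := eqVneq b 0; first by rewrite linear0r !normr0 mulr0.
have bb0 : 0 < `|b| ^+ 2 by rewrite exprn_gt0// normr_gt0.
pose c := dotp a b.
have : 0 <= `|(`|b| ^+ 2) *: a - c *: b| ^+ 2 by rewrite exprn_ge0.
rewrite normr_dotp linearBl/= !(linearBr dotp)/=.
rewrite !(linearZl_LR dotp)/= !(linearZr_LR dotp)/=.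
rewrite -!normr_dotp (dotpC a b) -/c (conj_Creal (ger0_real _)) ?exprn_ge0//.
rewrite [X in 0 <= X](_ : _ =
    `|b| ^+ 2 * ((`|a| * `|b|) ^+ 2 - c * Num.conj c)); last first.
  ring.
rewrite pmulr_rge0// subr_ge0 -normCK ler_sqr ?nnegrE// mulr_ge0.
Qed.

Lemma dotp_continuous : continuous (fun p : V * V => dotp p.1 p.2 : C^o).
Proof.
move=> [a b]; apply/(@cvgrPdist_lt C C^o) => e e0.
have d0 (c : V) : 0 < e / 2 / (`|c| + 1) by rewrite !divr_gt0// ltr_wpDl.
have cv1 : q.1 @[q --> (a, b)] --> a by exact: cvg_fst.
have cv2 : q.2 @[q --> (a, b)] --> b by exact: cvg_snd.
move/cvgrPdist_lt in cv1; move/cvgrPdist_lt in cv2.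
near=> p => /=.
have -> : dotp a b - dotp p.1 p.2 = dotp (a - p.1) p.2 + dotp a (b - p.2).
  by rewrite linearBl/= (linearBr dotp)/= [RHS]addrC addrA subrK.
rewrite [e]splitr (le_lt_trans (ler_normD _ _))//; apply: ltrD.
- apply: le_lt_trans (dotp_cauchy_schwarz _ _) _.
  apply: (@le_lt_trans _ _ (`|a - p.1| * (`|b| + 1))).
    rewrite ler_wpM2l// -[p.2](subrK b) (le_trans (ler_normD _ _))//.
    rewrite addrC lerD2l distrC ltW//; near: p.
    exact: cv2.
  rewrite -ltr_pdivlMr ?ltr_wpDl//; near: p.
  exact: cv1.
- apply: le_lt_trans (dotp_cauchy_schwarz _ _) _.
  apply: (@le_lt_trans _ _ (`|b - p.2| * (`|a| + 1))).
    by rewrite mulrC ler_wpM2l// lerDl.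
  rewrite -ltr_pdivlMr ?ltr_wpDl//; near: p.
  exact: cv2.
Unshelve. all: by end_near.
Qed.

Lemma dotp_continuousl b : continuous (fun a => dotp a b : C^o).
Proof.
move=> a; apply: (@continuous_comp _ _ _ (fun a => (a, b)) (fun p => dotp p.1 p.2 : C^o)).
  by apply: cvg_pair; [exact: cvg_id|exact: cvg_cst].
exact: dotp_continuous.
Qed.

Lemma dotp_continuousr a : continuous (fun b => dotp a b : C^o).
Proof.
move=> b; apply: (@continuous_comp _ _ _ (fun b => (a, b)) (fun p => dotp p.1 p.2 : C^o)).
  by apply: cvg_pair; [exact: cvg_cst|exact: cvg_id].
exact: dotp_continuous.
Qed.

End Form.

(** Vanishing at u + v makes the form skew-symmetric.  Applied to u and 'i v,
    skew-symmetry turns into symmetry, because the form is conjugate-linear in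
    one argument only; so the form is its own opposite. *)
Lemma sesquilinear_polarization (V : lmodType C)
    (f : {bilinear V -> V -> C | *%R & @Num.conj C \; *%R}) :
  (forall v, f v v = 0) -> forall u v, f u v = 0.
Proof.
move=> f0 u v.
have skew x y : f x y = - f y x.
  apply/eqP; rewrite -addr_eq0; apply/eqP; have := f0 (x + y).
  by rewrite (linearDl f)/= !(linearDr f)/= !f0 add0r addr0.
have := skew u ('i *: v).
rewrite (linearZr_LR f)/= (linearZl_LR f)/= conjCi mulNr => /oppr_inj.
move=> /(mulfI (neq0Ci _)) fuv.
have /eqP := skew u v; rewrite -fuv -addr_eq0 -mulr2n mulrn_eq0/=.
by move=> /eqP.
Qed.

End InnerProduct.

(** * Continuous representable functionals are positive *)

Section ContinuousRepresentable.
Context {R : realType} {A0 : starAlgType R} {A : normedModType R[i]}.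
Variable X : normedQuasiStarAlg A0 A.

Lemma cont_representable_positive :
  cont_representable X `<=` positive_functional X.
Proof.
move=> w [[wpos _ _] wc] a.
have cl : closed [set b | 0 <= w b].
  have -> : [set b | 0 <= w b] = (w : A -> R[i]^o) @^-1` [set z | 0 <= z] by [].
  by apply: preimage_closed => [b _|]; [exact: wc|exact: closed_ge0_complex].
have := closure_subset (A := qinj X @` @pos_cone0 R A0) (B := [set b | 0 <= w b]).
rewrite -((closure_id _).1 cl) => sub; apply: sub => {a cl}.
move=> _ [_ [n [s ->]] <-] /=; rewrite !linear_sum/=.
by apply: sumr_ge0 => i _; exact: wpos.
Qed.

End ContinuousRepresentable.

(** * Hilbert quasi *-algebras *)

Section StarAlgebra.
Context {R : realType} {A0 : starAlgType R}.
Implicit Types x y : A0.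

Lemma starZ c x : star (c *: x) = Num.conj c *: star x.
Proof. exact: (GRing.scalable_linear (@star_antilinear R A0)). Qed.

Lemma smulZl c x y : smul (c *: x) y = c *: smul x y.
Proof. exact: (GRing.scalable_linear (@smul_linearl R A0 y)). Qed.

Lemma smulZr c x y : smul x (c *: y) = c *: smul x y.
Proof. exact: (GRing.scalable_linear (@smul_linearr R A0 x)). Qed.

End StarAlgebra.

Section HilbertQuasi.
Context {R : realType} {A0 : hilbertAlgType R} {H : hilbertType R}.
Variable X : hilbertQuasiStarAlg A0 H.
Local Notation C := R[i].

Lemma dotp_hq_lmul x a b :
  dotp (hq_lmul X x a) b = dotp a (hq_lmul X (star x) b).
Proof.
move: a; apply: (@hq_ext _ _ _ X C^o (fun a => dotp (hq_lmul X x a) b)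
  (fun a => dotp a (hq_lmul X (star x) b))).
- move=> a; apply: (@continuous_comp _ _ _ (hq_lmul X x) (fun a => dotp a b : C^o)).
    exact: hq_lmul_continuous.
  exact: dotp_continuousl.
- exact: dotp_continuousl.
move=> y; move: b; apply: (@hq_ext _ _ _ X C^o
  (fun b => dotp (hq_lmul X x (hq_inj X y)) b)
  (fun b => dotp (hq_inj X y) (hq_lmul X (star x) b))).
- exact: dotp_continuousr.
- move=> b; apply: (@continuous_comp _ _ _ (hq_lmul X (star x))
    (fun b => dotp (hq_inj X y) b : C^o)).
    exact: hq_lmul_continuous.
  exact: dotp_continuousr.
by move=> z; rewrite !hq_lmul_inj !hq_dotp dotp_smul.
Qed.

(** This identity makes the inner product one of the invariant forms that detect
    *-semisimplicity. *)
Lemma dotp_hq_rmul a x y :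
  dotp (hq_rmul X a x) (hq_inj X y) =
  dotp (hq_inj X x) (hq_rmul X (hq_star X a) y).
Proof.
move: a; apply: (@hq_ext _ _ _ X C^o
  (fun a => dotp (hq_rmul X a x) (hq_inj X y))
  (fun a => dotp (hq_inj X x) (hq_rmul X (hq_star X a) y))).
- move=> a; apply: (@continuous_comp _ _ _ (hq_rmul X ^~ x)
    (fun a => dotp a (hq_inj X y) : C^o)).
    exact: hq_rmul_continuous.
  exact: dotp_continuousl.
- move=> a; apply: (@continuous_comp _ _ _ (hq_star X)
    (fun a => dotp (hq_inj X x) (hq_rmul X a y) : C^o)).
    exact: hq_star_continuous.
  apply: (@continuous_comp _ _ _ (hq_rmul X ^~ y)
    (fun a => dotp (hq_inj X x) a : C^o)).
    exact: hq_rmul_continuous.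
  exact: dotp_continuousr.
by move=> z; rewrite hq_star_inj !hq_rmul_inj !hq_dotp dotp_smul.
Qed.

Lemma dotp_dense_eq0 a : (forall y, dotp a (hq_inj X y) = 0) -> a = 0.
Proof.
move=> a0; apply/eqP; rewrite -normr_eq0 -sqrf_eq0 normr_dotp; apply/eqP.
apply: (@hq_ext _ _ _ X C^o (fun b => dotp a b) (fun=> 0)) => //.
  exact: dotp_continuousr.
by move=> b; exact: cvg_cst.
Qed.

Lemma hilbert_star_semisimple : star_semisimple X.
Proof.
have dotp_norm (b : H) : dotp b b = `|b| ^+ 2 by rewrite normr_dotp.
move=> a a0; exists (dotp : {bilinear H -> H -> C | *%R & @Num.conj C \; *%R}).
  split.
  - exact: dotp_continuous.
  - by move=> b; rewrite [leRHS]dotp_norm exprn_ge0.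
  - exact: dotp_hq_rmul.
  - exact: dotp_cauchy_schwarz.
by rewrite [ltRHS]dotp_norm exprn_gt0// normr_gt0.
Qed.

Section VectorFunctional.
Variable u : A0.

Definition vector_functional (a : H) : C := dotp (hq_rmul X a u) (hq_inj X u).

Fact vector_functional_linear : linear_for *%R vector_functional.
Proof.
move=> c a b; rewrite /vector_functional hq_rmul_linearl (linearDl dotp)/=.
by rewrite (linearZl_LR dotp).
Qed.

HB.instance Definition _ :=
  GRing.isLinear.Build C H C *%R vector_functional vector_functional_linear.

Lemma vector_functional_square x :
  vector_functional (hq_inj X (smul (star x) x)) = `|hq_inj X (smul x u)| ^+ 2.
Proof.
by rewrite /vector_functional hq_rmul_inj hq_dotp -smulA dotp_smul starK
  hq_norm_inj normr_dotp.
Qed.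

(** Moving factors across the inner product turns w(y^* a x) into
    <a (x u) | y u>, whose hermitian symmetry is the one asked of w, and w(a^* x)
    into <x u | a u>, which the Cauchy-Schwarz inequality bounds by `|a u| times
    w(x^* x)^(1/2), since w(x^* x) = `|x u|^2. *)
Lemma vector_functional_cont_representable :
  cont_representable X vector_functional.
Proof.
have rmulE a x : dotp (hq_rmul X (hq_rmul X a x) u) (hq_inj X u) =
    dotp (hq_inj X (smul x u)) (hq_rmul X (hq_star X a) u).
  by rewrite -hq_rmulA dotp_hq_rmul.
split; last first.
  move=> a; apply: (@continuous_comp _ _ _ (hq_rmul X ^~ u)
    (fun a => dotp a (hq_inj X u) : C^o)).
    exact: hq_rmul_continuous.
  exact: dotp_continuousl.
split.
- by move=> x /=; rewrite vector_functional_square exprn_ge0.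
- have sandwich a x y :
      dotp (hq_rmul X (hq_rmul X (hq_lmul X (star y) a) x) u) (hq_inj X u) =
      dotp (hq_rmul X a (smul x u)) (hq_inj X (smul y u)).
    by rewrite -hq_rmulA hq_lrmulA dotp_hq_lmul starK hq_lmul_inj.
  move=> x y a /=; rewrite /vector_functional !sandwich -dotpC.
  by rewrite dotp_hq_rmul hq_starK.
(* The summand 1 makes the constant positive even when a u = 0. *)
- move=> a; exists (`|hq_rmul X a u| + 1); first by rewrite ltr_wpDl.
  move=> x /=; rewrite vector_functional_square sqrCK// /vector_functional rmulE.
  rewrite hq_starK (le_trans (dotp_cauchy_schwarz _ _))// mulrC ler_wpM2r//.
  by rewrite lerDl.
Qed.

End VectorFunctional.

(** A positive element killed by all vector functionals is 0, by polarization. *)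
Lemma hilbert_sufficient : unital X -> sufficient X (cont_representable X).
Proof.
move=> X1; split; first exact: cont_representable_positive.
move=> a apos a0; apply: contrapT => nw.
have w0 u : vector_functional u a = 0.
  apply/eqP; apply: contrapT => /negP wu; apply: nw.
  exists (vector_functional u); first exact: vector_functional_cont_representable.
  rewrite lt_def wu /=.
  have uR := vector_functional_cont_representable u.
  exact: cont_representable_positive uR _ apos.
pose f (x y : A0) := dotp (hq_rmul X a x) (hq_inj X y).
have fbil : bilinear_for *%R (@Num.conj C \; *%R) f.
  split=> [y c x z|x c y z]; rewrite /f.
    by rewrite hq_rmul_linearr (linearDl dotp)/= (linearZl_LR dotp).
  by rewrite linearP (linearDr dotp)/= (linearZr_LR dotp).
pose F : {bilinear A0 -> A0 -> C | *%R & @Num.conj C \; *%R} :=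
  HB.pack f (bilinear_isBilinear.Build C A0 A0 C *%R (@Num.conj C \; *%R) f fbil).
case: X1 => e eP; move/eqP: a0; apply.
rewrite -(eP a).1; apply: dotp_dense_eq0 => y.
exact: (@sesquilinear_polarization _ _ F w0).
Qed.

(** The uniform boundedness principle applies to the functionals a |-> w(x^* a)
    with w(x^* x) <= 1.  The unit is what relates w(x^* a) to w(a^* x): take one
    of the two outer factors to be 1 in the hermitian condition on w. *)
Lemma cont_representable_bounded w : unital X -> cont_representable X w ->
  exists2 M : C, 0 < M & forall x : A0,
    w (hq_inj X (smul (star x) x)) <= (M * `|x|) ^+ 2.
Proof.
move=> X1 [[wpos wherm wbnd] wc].
have [e re] : exists e, forall a, hq_rmul X a e = a.
  by case: X1 => e eP; exists e => a; have [] := eP a.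
pose f (x : A0) (a : H) : C := w (hq_lmul X x a).
have flin x : linear_for *%R (f x).
  by move=> c a b; rewrite /f hq_lmul_linearr linearP.
pose g x : {scalar H} := HB.pack (f x) (GRing.isLinear.Build C H C *%R (f x) (flin x)).
pose F : set {scalar H} := [set h | exists2 x : A0,
  w (hq_inj X (smul (star x) x)) <= 1 & h = g (star x)].
have Fc h : F h -> continuous (h : H -> C^o).
  move=> [x _ ->] a /=.
  apply: (@continuous_comp _ _ _ (hq_lmul X (star x)) (w : H -> C^o)).
    exact: hq_lmul_continuous.
  exact: wc.
have Fb a : exists M : C, forall h, F h -> `|h a| <= M.
  have [M M0 MP] := wbnd a; exists M => _ [x x1 ->] /=.
  have -> : f (star x) a = Num.conj (w (hq_rmul X (hq_star X a) x)).
    have /= := wherm x e a; rewrite re.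
    by rewrite -hq_star_rmul re => ->; rewrite conjCK.
  rewrite norm_conjC (le_trans (MP x))// ler_piMr ?(ltW M0)//.
  by rewrite -sqrtC1 ler_sqrtC ?nnegrE//; exact: wpos.
have [M M0 MP] := uniform_boundedness Fc Fb.
exists M => // x; set s := w _.
have s0 : 0 <= s := wpos x.
have [->|sn0] := eqVneq s 0; first by rewrite exprn_ge0// mulr_ge0// ltW.
set r := sqrtC s; have rs : r ^+ 2 = s by rewrite sqrtCK.
have r0 : 0 < r by rewrite sqrtC_gt0 lt_def sn0.
(* Normalizing x for the form puts it in the family; the value at x itself is
   then r, so the uniform bound reads r <= M * `|x|. *)
pose y := r^-1 *: x.
have wy z : w (hq_inj X (smul (star y) z)) =
    r^-1 * w (hq_inj X (smul (star x) z)).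
  rewrite starZ smulZl linearZ/= linearZ/=.
  by rewrite conj_Creal// ger0_real// invr_ge0 ltW.
have Fy : F (g (star y)).
  exists y => //; rewrite wy /y smulZr linearZ/= linearZ/= -/s -rs.
  by rewrite mulrA -expr2 exprVn mulVf// expf_neq0// gt_eqF.
have := MP _ Fy (hq_inj X x).
rewrite /= /f hq_lmul_inj wy -/s -rs expr2 mulKf ?gt_eqF// hq_norm_inj.
by rewrite gtr0_norm// => rM; rewrite expr2 ler_pM// ltW.
Qed.

(** Since the form of w is bounded by the norm, any approximating sequence of a in
    A0 serves for every w. *)
Lemma hilbert_repr_domain : unital X -> repr_domain X = setT.
Proof.
move=> X1; apply/seteqP; split=> // a _; right=> w wR.
have [M M0 MP] := cont_representable_bounded X1 wR.
have approx n : exists x, `|hq_inj X x - a| < n.+1%:R^-1 :> C.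
  have n0 : 0 < n.+1%:R^-1 :> C by rewrite invr_gt0 ltr0n.
  have [||b [/= ab [x _ xb]]] := @hq_dense _ _ _ X (ball a n.+1%:R^-1).
  - by exists a; exact: ballxx.
  - exact: ball_open.
  by exists x; move: ab; rewrite -xb -ball_normE /ball_/= distrC.
have [x xP] := choice approx.
have xa : hq_inj X (x n) @[n --> \oo] --> a.
  apply/cvgrPdist_lt => e /invSn_lt_complex[n ne]; exists n => // m /= nm.
  rewrite distrC (lt_trans (xP m))// (le_lt_trans _ ne)//.
  by rewrite lef_pV2 ?posrE ?ltr0n// ler_nat.
exists x; split; first exact: xa.
apply/(@cvgrPdist_lt C C^o) => e e0.
(* Two terms within d of a are within 2 d of each other, and (M * 2 d)^2 = e. *)
pose d := sqrtC e / M / 2.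
have d0 : 0 < d by rewrite !divr_gt0// sqrtC_gt0.
move/cvgrPdist_lt/(_ d d0) in xa.
have near1 : \forall nm \near (\oo, \oo), `|a - hq_inj X (x nm.1)| < d.
  exact: (@cvg_fst _ _ _ _ _ _ xa).
have near2 : \forall nm \near (\oo, \oo), `|a - hq_inj X (x nm.2)| < d.
  exact: (@cvg_snd _ _ _ _ _ _ xa).
near=> nm; rewrite sub0r normrN /assoc_form.
set y := x nm.1 - x nm.2.
rewrite ger0_norm; last by case: wR => -[+ _ _] _; apply.
rewrite (le_lt_trans (MP y))// -[ltRHS]sqrtCK.
rewrite ltr_sqr ?nnegrE ?sqrtC_ge0 ?mulr_ge0 ?(ltW M0) ?(ltW e0)//.
rewrite mulrC -ltr_pdivlMr// -(hq_norm_inj X) linearB/=.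
rewrite -(subrK a (hq_inj X _)) -addrA (le_lt_trans (ler_normD _ _))//.
rewrite [ltRHS]splitr; apply: ltrD; last by near: nm.
by rewrite distrC; near: nm.
Unshelve. all: by end_near.
Qed.

End HilbertQuasi.

(** * The tensor product *)

Section TensorUnit.
Context {R : realType}.

(** Elementary tensors determine linear maps: both maps are the unique
    factorization of the same bilinear map. *)
Lemma alg_tensor_ext (U V W E : lmodType R[i]) (t : {bilinear U -> V -> W})
    (g h : {linear W -> E}) :
  is_alg_tensor t -> (forall u v, g (t u v) = h (t u v)) -> g =1 h.
Proof.
move=> tP gh.
pose f u v := h (t u v).
have fbil : bilinear_for *:%R *:%R f.
  split=> [v c u u'|u c v v']; rewrite /f.
    by rewrite linearPl linearP.
  by rewrite linearPr linearP.
have [k [_ kP]] := tP E (HB.pack f (bilinear_isBilinear.Build _ U V E *:%R *:%R f fbil)).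
by move=> x; rewrite kP// [RHS]kP.
Qed.

Lemma tensor_hilbert_unital (A0 B0 T0 : hilbertAlgType R)
    (H1 H2 H : hilbertType R) (X : hilbertQuasiStarAlg A0 H1)
    (Y : hilbertQuasiStarAlg B0 H2) (Z : hilbertQuasiStarAlg T0 H)
    (t : {bilinear A0 -> B0 -> T0}) (th : {bilinear H1 -> H2 -> H}) :
  unital X -> unital Y -> is_tensor_hilbert_quasi X Y Z t th -> unital Z.
Proof.
move=> [e eP] [f fP] hZ.
have unitA x : smul x e = x /\ smul e x = x.
  have [re le] := eP (hq_inj X x); split; apply: (@hq_inj_inj _ _ _ X).
    by rewrite -hq_rmul_inj.
  by rewrite -hq_lmul_inj.
have unitB x : smul x f = x /\ smul f x = x.
  have [rf lf] := fP (hq_inj Y x); split; apply: (@hq_inj_inj _ _ _ Y).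
    by rewrite -hq_rmul_inj.
  by rewrite -hq_lmul_inj.
pose u := t e f.
pose ru : {linear T0 -> T0} :=
  HB.pack (smul ^~ u) (GRing.isLinear.Build _ _ _ _ _ (@smul_linearl R T0 u)).
pose lu : {linear T0 -> T0} :=
  HB.pack (smul u) (GRing.isLinear.Build _ _ _ _ _ (@smul_linearr R T0 u)).
have ruE : ru =1 idfun.
  apply: (alg_tensor_ext (h := idfun) (tp_alg hZ)) => x y /=.
  by rewrite (tp_mul hZ) (unitA x).1 (unitB y).1.
have luE : lu =1 idfun.
  apply: (alg_tensor_ext (h := idfun) (tp_alg hZ)) => x y /=.
  by rewrite (tp_mul hZ) (unitA x).2 (unitB y).2.
have cid : continuous (@idfun H) by move=> a; exact: cvg_id.
exists u => a; split; move: a; apply: (@hq_ext _ _ _ Z H) => //.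
- exact: hq_rmul_continuous.
- by move=> x /=; rewrite hq_rmul_inj; congr (hq_inj Z _); exact: ruE.
- exact: hq_lmul_continuous.
- by move=> x /=; rewrite hq_lmul_inj; congr (hq_inj Z _); exact: luE.
Qed.

End TensorUnit.

Theorem corollary3p7 (R : realType) (A0 B0 T0 : hilbertAlgType R)
    (H1 H2 H : hilbertType R)
    (X : hilbertQuasiStarAlg A0 H1) (Y : hilbertQuasiStarAlg B0 H2)
    (hX : unital X) (hY : unital Y)
    (Z : hilbertQuasiStarAlg T0 H)
    (t : {bilinear A0 -> B0 -> T0}) (th : {bilinear H1 -> H2 -> H})
    (hZ : is_tensor_hilbert_quasi X Y Z t th) :
  star_semisimple Z /\ fully_representable Z.
Proof.
have Z1 : unital Z := tensor_hilbert_unital hX hY hZ.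
split; first exact: hilbert_star_semisimple.
by split; [exact: hilbert_sufficient|exact: hilbert_repr_domain].
Qed.
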